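(* Let $T_n$ be a tree with $n$ vertices and maximum degree $\Delta$. If $p\geq 1$ is a real number, then $$A_p(T_n)\geq \left(\Delta\, \varepsilon^{1-p}(v_{\Delta})\right)^{\frac{1}{p}}(\Delta-1),$$ where $v_{\Delta}$ is a vertex of maximum degree.
   Context: $d(v)$ is the degree of vertex $v$. For a positive real number $p$, the general Albertson irregularity index of a connected graph $G$ is $A_p(G)=\left(\sum_{uv\in E(G)}|d(u)-d(v)|^p\right)^{1/p}$. The eccentricity $\varepsilon(v)$ of a vertex $v$ is the distance between $v$ and a vertex furthest from $v$ in the graph (distance being the length of a shortest path), and $\varepsilon^{1-p}(v)=(\varepsilon(v))^{1-p}$. *)

(* Defs.v *)
From mathcomp Require Import all_boot all_order all_algebra.
From mathcomp Require Import all_classical all_reals all_analysis.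

Set Implicit Arguments.
Unset Strict Implicit.
Unset Printing Implicit Defensive.

Import Order.TTheory GRing.Theory Num.Theory.

(* A finite simple graph is a symmetric irreflexive relation on a finType. *)
Section Graph.
Variables (V : finType) (e : rel V).

Definition simple_graph : Prop := symmetric e /\ irreflexive e.

Definition connected_graph : Prop :=
  0 < #|V| /\ forall u v : V, connect e u v.

(* [ucycle] accepts [:: u; v] for an edge uv, hence the lower bound on size. *)
Definition acyclic_graph : Prop :=
  ~ exists2 c : seq V, 2 < size c & ucycle e c.

Definition tree : Prop :=
  [/\ simple_graph, connected_graph & acyclic_graph].

Definition deg (v : V) : nat := #|[set u | e v u]|.

Definition max_deg : nat := \max_(v : V) deg v.

(* [s] lists the vertices of the path after [u], so its size is the number of
   edges. *)
Definition is_path (u v : V) (s : seq V) : bool :=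
  [&& path e u s, last u s == v & uniq (u :: s)].

(* A path repeats no vertex, so its length is less than #|V|; #|V| is the
   default value when there is no path. *)
Definition dist (u v : V) : nat :=
  \big[minn/#|V|]_(k < #|V| | [exists s : k.-tuple V, is_path u v s]) k.

Definition ecc (v : V) : nat := \max_(u : V) dist v u.

Local Open Scope ring_scope.

(* Comparing ranks in the enumeration of V selects exactly one orientation of
   each edge. *)
Definition albertson (R : realType) (p : R) : R :=
  (\sum_(uv : V * V | e uv.1 uv.2 && (enum_rank uv.1 < enum_rank uv.2)%N)
     `|(deg uv.1)%:R - (deg uv.2)%:R| `^ p) `^ p^-1.

End Graph.

(* Main.v *)
(* Follow each of the Delta edges at the vertex of maximum degree along a path
   that cannot be prolonged.  As paths in a tree are unique, the resulting
   branches are edge-disjoint, each has length at most the eccentricity k, and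
   each ends in a leaf.  Along one branch the degree drops by at least Delta - 1
   in at most k steps, so by the power mean inequality its edges contribute at
   least k ^ (1 - p) * (Delta - 1) ^ p; sum over the Delta branches. *)

Require Import Defs.
From mathcomp Require Import all_boot all_order all_algebra.
From mathcomp Require Import all_classical all_reals all_analysis.
From mathcomp Require Import ring.

Set Implicit Arguments.
Unset Strict Implicit.

Import Order.TTheory GRing.Theory Num.Theory.
Local Open Scope ring_scope.

(** * Directed edges of a path *)

Section Steps.
Variables (V : eqType).
Implicit Types (x : V) (s : seq V) (c : V * V).

Definition steps x s : seq (V * V) := pairmap pair x s.

Lemma mem_path_cat x s y : y \in x :: s ->
  exists p1 p2, s = p1 ++ p2 /\ last x p1 = y.
Proof. by case/splitPl=> p1 p2 <-; exists p1, p2. Qed.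

Lemma steps_edge (e : rel V) x s c : path e x s -> c \in steps x s -> e c.1 c.2.
Proof.
elim: s x => [|y s IH] x //= /andP[exy ps]; rewrite inE => /orP[/eqP->//|].
exact: IH.
Qed.

Lemma steps_head x s c : c \in steps x s -> c.1 \in x :: s.
Proof.
elim: s x => [|y s IH] x //=; rewrite inE => /orP[/eqP->/=|/IH].
  by rewrite inE eqxx.
by move=> cs; rewrite in_cons; apply/orP; right.
Qed.

Lemma unzip2_steps x s : unzip2 (steps x s) = s.
Proof. by elim: s x => [|y s IH] x //=; rewrite IH. Qed.

Lemma steps_tail x s c : c \in steps x s -> c.2 \in s.
Proof. by move=> /(map_f snd); rewrite -/(unzip2 _) unzip2_steps. Qed.

Lemma uniq_steps x s : uniq s -> uniq (steps x s).
Proof. by rewrite -{1}(unzip2_steps x s); apply: map_uniq. Qed.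

(** Every step after the first avoids [x] at both ends, so the first step is never reversed; the
    others follow by induction. *)
Lemma steps_asym x s a b :
  uniq (x :: s) -> (a, b) \in steps x s -> (b, a) \notin steps x s.
Proof.
elim: s x a b => [|y s IH] x a b //= /andP[xys /andP[ys us]].
have notx c : c \in steps y s -> (c.1 != x) && (c.2 != x).
  move=> cs; have := steps_head cs; have := steps_tail cs.
  move: xys; rewrite inE negb_or => /andP[xy xs] c2 c1.
  apply/andP; split; apply: contraNneq xs => cx; rewrite -cx //.
  by move: c1; rewrite inE => /orP[/eqP c1|//]; move: xy; rewrite -cx c1 eqxx.
rewrite !inE => /orP[/eqP[-> ->]|ab]; rewrite negb_or xpair_eqE.
  apply/andP; split; last by apply/negP => /notx /=; rewrite eqxx andbF.
  by move: xys; rewrite inE negb_or eq_sym => /andP[/negPf ->].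
have /andP[_ /= /negPf -> /=] := notx _ ab.
by apply: IH ab; rewrite /= ys.
Qed.

End Steps.

(** * Paths and branches in an acyclic graph *)

Section Acyclic.
Variables (V : finType) (e : rel V).
Hypotheses (esym : symmetric e) (eirr : irreflexive e) (eacy : acyclic_graph e).

(* Two paths leaving x through distinct neighbours close up, outside x, into a
   cycle through x. *)
Lemma acyclic_upath_unique x s t :
  path e x s -> uniq (x :: s) -> path e x t -> uniq (x :: t) ->
  last x s = last x t -> s = t.
Proof.
elim: s x t => [|y s IH] x [|z t] //.
- by move=> _ _ _ /= /andP[xt _] xE; rewrite xE mem_last in xt.
- by move=> _ /= /andP[xt _] _ _ xE; rewrite -xE mem_last in xt.
have [<-|yz] := eqVneq y z.
  move=> /= /andP[_ ps] /andP[_ us] /andP[_ pt] /andP[_ ut] l.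
  by rewrite (IH y t).
move=> /= /andP[exy ps] /andP[xs us] /andP[exz pt] /andP[xt ut] l.
pose e' := [rel a b | [&& e a b, a != x & b != x]].
have e'sym : connect_sym e'.
  by apply: sym_connect_sym => a b /=; rewrite esym [(a != x) && _]andbC.
have e'path a r : path e a r -> x \notin a :: r -> connect e' a (last a r).
  move=> pr xr; apply/connectP; exists r => //.
  elim: r a pr xr => //= b r IHr a /andP[eab pr].
  rewrite inE negb_or => /andP[xa xr].
  rewrite IHr // andbT /e' /= eab eq_sym xa /=.
  by move: xr; rewrite inE negb_or eq_sym => /andP[].
have : connect e' y z.
  apply: connect_trans (e'path _ _ ps xs) _; rewrite l e'sym.
  exact: e'path.
case/connectP => q0 /shortenP[q pq uq _] zE {q0}.
have pxq : path e y q && (x \notin q).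
  elim: (q) y pq {ps xs us uq yz l zE exy} => //= b r IHr a.
  move=> /andP[/and3P[eab _ bx] /IHr/andP[-> xr]].
  by rewrite eab inE negb_or eq_sym bx.
case/andP: pxq => pq' xq; exfalso; apply: eacy.
exists [:: x, y & q].
  (* As [y != z], [q] is nonempty, so the cycle has at least three vertices. *)
  by case: q zE yz {pq uq pq' xq} => //= ->; rewrite eqxx.
rewrite /ucycle /ucycleb /= rcons_path exy pq' -zE esym exz /=.
have -> : x \notin y :: q.
  rewrite inE negb_or xq andbT; apply: contraNneq xs => ->.
  by rewrite mem_head.
exact: uq.
Qed.

(** By uniqueness, every path from [x] to [last x s] has size [size s], so the minimum defining the
    distance is at least that. *)
Lemma size_upath_ecc x s : path e x s -> uniq (x :: s) -> (size s <= ecc e x)%N.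
Proof.
move=> ps us; apply: leq_trans (leq_bigmax (last x s)).
rewrite /dist; elim/big_ind: _ => [|a b sa sb|k /existsP[t /and3P[pt /eqP lt ut]]].
(* The default value [#|V|] of the minimum: a path has fewer edges than there are vertices. *)
- by rewrite ltnW // -[(size s).+1]/(size (x :: s)) -(card_uniqP us) max_card.
- by rewrite leq_min sa.
by rewrite (acyclic_upath_unique ps us pt ut) ?size_tuple.
Qed.

(** Take a longest path that starts with the edge from [x] to [u]: the only neighbour of its end is
    the vertex just before it. *)
Lemma acyclic_branch x u : e x u ->
  exists s, [/\ path e x (u :: s), uniq (x :: u :: s) & (deg e (last u s) <= 1)%N].
Proof.
move=> exu.
pose P k := `[< exists s, [/\ path e x (u :: s), uniq (x :: u :: s) & size s = k] >].
have P0 : exists k, P k.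
  exists 0%N; apply/asboolP; exists [::]; split => //=; rewrite ?exu //.
  by rewrite inE andbT; apply: contraTneq exu => ->; rewrite eirr.
have Pb k : P k -> (k <= #|V|)%N.
  move=> /asboolP[s [_ us <-]].
  apply: leq_trans (max_card (mem (x :: u :: s))).
  by rewrite (card_uniqP us) /= ltnW.
case: (ex_maxnP P0 Pb) => k /asboolP[s [ps us sk]] kmax.
exists s; split => //.
have nb y : e (last u s) y -> y = last x (belast u s).
  move=> ey.
  have [yin|yout] := boolP (y \in x :: u :: s); last first.
    suff /kmax : P k.+1 by rewrite ltnn.
    apply/asboolP; exists (rcons s y); split.
    - by rewrite -rcons_cons rcons_path ps.
    - by rewrite -!rcons_cons rcons_uniq yout.
    - by rewrite size_rcons sk.
  have lE : last x (u :: s) = last u s by [].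
  have [p1 [p2 [pE lp1]]] := mem_path_cat yin.
  move: (ps) (us) lE; rewrite pE cat_path lp1 last_cat lp1 => /andP[pp1 pp2].
  rewrite -cat_cons lastI lp1 cat_rcons cat_uniq => /and3P[_ _ up2] lp2.
  (* [p2] and the single edge from [y] both lead to the end of the path, so they coincide. *)
  have p2E : p2 = [:: last u s].
    apply: (@acyclic_upath_unique y) => //=; first by rewrite esym ey.
    by rewrite inE andbT; apply: contraTneq ey => ->; rewrite eirr.
  by move: pE; rewrite p2E cats1 (lastI u s) => /rcons_inj[->]; rewrite lp1.
rewrite /deg; apply/card_le1_eqP => a b; rewrite !inE => /nb-> /nb->//.
Qed.

(** Cut at [b], both paths become the same path from [x] to [b]. Hence branches through distinct
    neighbours meet only at [x]. *)
Lemma upath_prefix_head x u s b : path e x (u :: s) -> uniq (x :: u :: s) ->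
  b \in u :: s -> forall v t, path e x (v :: t) -> uniq (x :: v :: t) ->
  b \in v :: t -> u = v.
Proof.
have prefix w r : path e x (w :: r) -> uniq (x :: w :: r) -> b \in w :: r ->
    exists q, [/\ path e x (w :: q), uniq (x :: w :: q) & last w q = b].
  move=> pw uw bw; have bw' : b \in x :: w :: r by rewrite inE bw orbT.
  have [[|w' q] [p2 [qE lq]]] := mem_path_cat bw'.
    by move: uw; rewrite -[x]/(last x [::]) lq cons_uniq bw.
  case: qE => wE rE; exists q; rewrite wE -lq; move: pw uw.
  rewrite wE rE -!cat_cons cat_path cat_uniq => /andP[-> _] /andP[-> _].
  by split.
move=> ps us bs v t pt ut bt.
have [q [pq uq lq]] := prefix _ _ ps us bs.
have [r [pr ur lr]] := prefix _ _ pt ut bt.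
have := acyclic_upath_unique pq uq pr ur.
by rewrite /= lq lr => /(_ erefl)[].
Qed.

End Acyclic.

(** * Power inequalities and sums over edges *)

Section Real.
Variable R : realType.
Implicit Types p : R.

(* Young's inequality with the conjugate exponent puts the graph of [x `^ p]
   above its tangent at m. *)
Lemma powR_tangent p (a m : R) : 1 <= p -> 0 <= a -> 0 <= m ->
  p * m `^ (p - 1) * a - (p - 1) * m `^ p <= a `^ p.
Proof.
move=> p1 a0 m0; have p0 : 0 < p by apply: lt_le_trans p1.
(* For [p = 1] there is no conjugate exponent, but both sides equal [a]. *)
move: p1; rewrite le_eqVlt => /predU1P[<-|p1].
  by rewrite subrr powRr0 !mul1r mul0r subr0 powRr1.
have q0 : 0 < p - 1 by rewrite subr_gt0.
have pq : p^-1 + (p / (p - 1))^-1 = 1.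
  by field; rewrite !gt_eqF.
have := conjugate_powR a0 (powR_ge0 m (p - 1)) p0 (divr_gt0 p0 q0) pq.
rewrite -powRrM (_ : (p - 1) * (p / (p - 1)) = p); last first.
  by field; rewrite gt_eqF.
rewrite -(ler_pM2l p0) lerBlDr.
have -> : p * (a `^ p / p + m `^ p / (p / (p - 1))) = a `^ p + (p - 1) * m `^ p.
  by field; rewrite !gt_eqF.
by rewrite -mulrA [a * _]mulrC.
Qed.

(* Summing the tangent inequality at the mean slope [D / k] gives the power
   mean inequality, with slack in the number of terms. *)
Lemma sum_powR_ge (I : Type) (r : seq I) (a : I -> R) p (k : nat) (D : R) :
  1 <= p -> (0 < k)%N -> (size r <= k)%N -> (forall i, 0 <= a i) -> 0 <= D ->
  D <= \sum_(i <- r) a i ->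
  k%:R `^ (1 - p) * D `^ p <= \sum_(i <- r) a i `^ p.
Proof.
move=> p1 k0 rk a0 D0 Da.
have p0 : 0 < p by apply: lt_le_trans p1.
have kR : 0 < k%:R :> R by rewrite ltr0n.
pose m := D / k%:R; have m0 : 0 <= m by rewrite divr_ge0 // (ltW kR).
have -> : k%:R `^ (1 - p) * D `^ p = k%:R * m `^ p.
  rewrite powRB; last by rewrite (gt_eqF kR) implybT.
  rewrite powRr1 ?(ltW kR) // /m powRM ?invr_ge0 ?(ltW kR) //.
  rewrite -[in RHS]powR_inv1 ?(ltW kR) // -powRrM mulN1r powRN.
  by rewrite -mulrA [_^-1 * _]mulrC.
apply: (@le_trans _ _
  (\sum_(i <- r) (p * m `^ (p - 1) * a i - (p - 1) * m `^ p))); last first.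
  by apply: ler_sum => i _; exact: powR_tangent.
rewrite sumrB -mulr_sumr big_const_seq count_predT iter_addr_0.
(* The value of the tangent bound for exactly [k] terms with sum [D]; a larger sum or fewer terms
   only increase it. *)
have -> : k%:R * m `^ p = p * m `^ (p - 1) * D - (p - 1) * m `^ p *+ k.
  have -> : D = k%:R * m by rewrite /m mulrC divfK // gt_eqF.
  by rewrite -mulr_natr -(mulr_powRB1 m0 p0); ring.
rewrite lerB //.
  by rewrite ler_wpM2l // mulr_ge0 ?powR_ge0 // ltW.
by rewrite ler_wpMn2l // mulr_ge0 ?powR_ge0 // subr_ge0.
Qed.

Lemma telescope_steps (V : eqType) (f : V -> R) x (s : seq V) :
  f x - f (last x s) <= \sum_(c <- steps x s) `|f c.1 - f c.2|.
Proof.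
elim: s x => [|y s IH] x /=; first by rewrite big_nil subrr.
rewrite big_cons/=; apply: le_trans (lerD (ler_norm _) (IH y)).
by rewrite addrA subrK.
Qed.

(** Turning each pair towards the larger rank preserves [F] and is injective on [L], which never
    holds both orientations of an edge. *)
Lemma sum_oriented_le (V : finType) (e : rel V) (F : V * V -> R) (L : seq (V * V)) :
  symmetric e -> irreflexive e ->
  (forall c, 0 <= F c) -> (forall a b, F (a, b) = F (b, a)) ->
  uniq L -> {in L, forall c, e c.1 c.2} ->
  (forall a b, (a, b) \in L -> (b, a) \notin L) ->
  \sum_(c <- L) F c <=
  \sum_(c : V * V | e c.1 c.2 && (enum_rank c.1 < enum_rank c.2)%N) F c.
Proof.
move=> esym eirr F0 Fsym uL Le Lasym.
pose nrm (c : V * V) :=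
  if (enum_rank c.1 < enum_rank c.2)%N then c else (c.2, c.1).
rewrite (eq_bigr (F \o nrm)) /=; last first.
  by move=> [a b] _; rewrite /nrm /=; case: ifP.
rewrite -(big_map nrm xpredT) big_uniq /=; last first.
  rewrite map_inj_in_uniq // => -[a b] [c d] abL cdL.
  have := Lasym _ _ abL; rewrite /nrm /=.
  by do 2 case: ifP => _ //; move=> + [ac bd]; rewrite -?ac -?bd ?ac ?bd ?cdL.
rewrite big_mkcond [leRHS]big_mkcond; apply: ler_sum => c _ /=.
case: ifP => [/mapP[[a b] abL ->]|_]; last by case: ifP.
have := Le _ abL; rewrite /nrm /= => eab.
case: ifP => /= ab; first by rewrite eab ab.
rewrite esym eab /=; case: ltngtP ab => // /val_inj/enum_rank_inj ab _.
by rewrite ab eirr in eab.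
Qed.

End Real.

(** * Summation over the branches at [vD] *)

Theorem theorem4p3 (R : realType) (n : nat) (V : finType) (e : rel V)
    (hn : #|V| = n) (hT : tree e) (p : R) (hp : 1 <= p)
    (vD : V) (hvD : deg e vD = max_deg e) :
  albertson e p >=
    ((max_deg e)%:R * (ecc e vD)%:R `^ (1 - p)) `^ p^-1 * ((max_deg e)%:R - 1).
Proof.
have [[esym eirr] _ eacy] := hT.
have p0 : 0 < p by apply: lt_le_trans hp.
(* In degree 0 the bound is 0; otherwise [d - 1] is nonnegative and [k] positive. *)
rewrite -hvD; have [d0|d0] := posnP (deg e vD).
  rewrite d0 mul0r powR0 ?mul0r ?powR_ge0 //.
  by rewrite invr_eq0 gt_eqF.
set d := deg e vD; set k := ecc e vD.
have [s sP] : exists s : V -> seq V, forall u, e vD u ->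
    [/\ path e vD (u :: s u), uniq (vD :: u :: s u) &
        (deg e (last u (s u)) <= 1)%N].
  suff /boolp.choice[s sP] : forall u, exists s, e vD u ->
      [/\ path e vD (u :: s), uniq (vD :: u :: s) & (deg e (last u s) <= 1)%N].
    by exists s.
  move=> u; have [eu|neu] := boolP (e vD u); last by exists [::].
  by have [s sP] := acyclic_branch esym eirr eacy eu; exists s.
pose f v : R := (deg e v)%:R.
pose F (c : V * V) := `|f c.1 - f c.2| `^ p.
pose L := [seq c | u <- enum (e vD), c <- steps vD (u :: s u)].
have head_unique u v b : e vD u -> e vD v -> b \in u :: s u -> b \in v :: s v ->
    u = v.
  move=> /sP[pu uu _] /sP[pv uv _] bu bv.
  exact: (upath_prefix_head esym eacy pu uu bu pv uv bv).
have D0 : 0 <= d%:R - 1 :> R by rewrite subr_ge0 ler1n.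
have k0 : (0 < k)%N.
  move: d0; rewrite card_gt0 => /set0Pn[u]; rewrite inE => eu.
  have [pu uu _] := sP u eu.
  exact: leq_trans (size_upath_ecc esym eacy pu uu).
(* The degree falls from [d] to at most 1 along at most [k] edges. *)
have branch u : e vD u ->
    k%:R `^ (1 - p) * (d%:R - 1) `^ p <= \sum_(c <- steps vD (u :: s u)) F c.
  move=> eu; have [pu uu lu] := sP u eu.
  apply: sum_powR_ge => //.
    rewrite size_pairmap; exact: size_upath_ecc.
  apply: le_trans (telescope_steps f vD (u :: s u)).
  by rewrite lerB // /f lern1.
have sumL : d%:R * (k%:R `^ (1 - p) * (d%:R - 1) `^ p) <= \sum_(c <- L) F c.
  rewrite /L big_allpairs_dep big_enum mulr_natl.
  have dE (y : R) : y *+ d = \sum_(u in e vD) y.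
    by rewrite sumr_const /d /deg cardsE.
  rewrite dE; exact: ler_sum.
have LP c : c \in L -> exists2 u, e vD u & c \in steps vD (u :: s u).
  case/allpairsPdep => u [c' [ul cl ->]]; exists u => //.
  by move: ul; rewrite mem_enum.
have Lle : \sum_(c <- L) F c <=
    \sum_(c : V * V | e c.1 c.2 && (enum_rank c.1 < enum_rank c.2)%N) F c.
  apply: sum_oriented_le => //.
  - by move=> c; exact: powR_ge0.
  - by move=> a b; rewrite /F distrC.
  - apply: allpairs_uniq_dep.
    + exact: enum_uniq.
    + move=> u; rewrite mem_enum => /sP[_ /andP[_ uu] _]; exact: uniq_steps.
    move=> _ _ /allpairsPdep[u [c [ul cl ->]]]
      /allpairsPdep[v [c' [vl c'l ->]]] /= cc'.
    rewrite -{}cc' in c'l *; rewrite !mem_enum in ul vl.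
    have -> // : u = v.
    (* The far end of a directed edge is never [vD], so it determines the branch. *)
    apply: (head_unique _ _ c.2 ul vl); apply: steps_tail; first exact: cl.
    exact: c'l.
  - by move=> c /LP[u /sP[pu _ _]]; exact: steps_edge.
  (* An edge and its reverse would both point away from [vD], so neither end is [vD] and both lie on
     one branch, which [steps_asym] excludes. *)
  move=> a b /LP[u eu abu]; apply/negP => /LP[v ev bav].
  have [_ uu _] := sP u eu.
  have /negP := steps_asym uu abu; apply.
  suff -> : u = v by [].
  have bu := steps_tail abu; have av := steps_tail bav.
  have := steps_head abu; rewrite inE => /orP[/eqP /= avD|au].
    by have [_ /andP[]] := sP v ev; rewrite -avD /= => /negP; case.
  exact: (head_unique u v a).
rewrite /albertson.
(* Moving [d - 1] under the root leaves only monotonicity of the power [p^-1]. *)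
have -> : (d%:R * k%:R `^ (1 - p)) `^ p^-1 * (d%:R - 1) =
    (d%:R * (k%:R `^ (1 - p) * (d%:R - 1) `^ p)) `^ p^-1.
  rewrite mulrA [RHS]powRM ?powR_ge0 ?mulr_ge0 ?powR_ge0 //.
  by rewrite -powRrM mulfV ?gt_eqF // powRr1.
apply: ge0_ler_powR.
- by rewrite invr_ge0 ltW.
- by rewrite nnegrE !mulr_ge0 ?powR_ge0.
- by rewrite nnegrE sumr_ge0 // => c _; exact: powR_ge0.
exact: le_trans sumL Lle.
Qed.
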